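(* Let $\mathcal{H}$ be a real Hilbert space, set $q=\|\cdot\|^2/2$, and let $T_1$ and $T_2$ be in $\mathcal{P}(\mathcal{H})$, say $T_1=\operatorname{prox}_{f_1}$ and $T_2=\operatorname{prox}_{f_2}$ for some $f_1$ and $f_2$ in $\Gamma_0(\mathcal{H})$. Suppose that $0\in\operatorname{sri}(\operatorname{dom}f_1^*-\operatorname{dom}f_2^* )$ and that $$(f_1^*+f_2^* )\mathbin{\square}q=f_1^*\mathbin{\square}q+f_2^*\mathbin{\square}q.$$ Then $T_1+T_2\in\mathcal{P}(\mathcal{H})$. More specifically, $T_1+T_2=\operatorname{prox}_{f_1\mathbin{\square}f_2}$.
   Context: $\Gamma_0(\mathcal{H})$ is the class of lower semicontinuous convex functions $f\colon\mathcal{H}\to\left]-\infty,+\infty\right]$ with $\operatorname{dom}f=\{x\in\mathcal{H}\mid f(x)<+\infty\}\neq\varnothing$. For $f\in\Gamma_0(\mathcal{H})$, the proximity operator $\operatorname{prox}_f\colon\mathcal{H}\to\mathcal{H}$ maps $x$ to the unique minimizer over $y\in\mathcal{H}$ of $f(y)+\frac12\|x-y\|^2$; $\mathcal{P}(\mathcal{H})$ is the set of operators $T\colon\mathcal{H}\to\mathcal{H}$ such that $T=\operatorname{prox}_f$ for some $f\in\Gamma_0(\mathcal{H})$. The conjugate of $f$ is $f^*\colon u\mapsto\sup_{x\in\mathcal{H}}(\langle x\mid u\rangle-f(x))$. The infimal convolution of $f$ and $g$ is $(f\mathbin{\square}g)(x)=\inf_{y\in\mathcal{H}}(f(y)+g(x-y))$;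 it binds more tightly than $+$ in the displayed identity. For a convex set $C\subset\mathcal{H}$, the strong relative interior $\operatorname{sri}C$ is the set of $x\in C$ such that the cone generated by $C-x$ is a closed vector subspace of $\mathcal{H}$. *)

(* Defs.v *)
From HB Require Import structures.
From mathcomp Require Import all_boot all_order all_algebra.
From mathcomp Require Import all_classical all_reals all_analysis.

Set Implicit Arguments.
Unset Strict Implicit.
Unset Printing Implicit Defensive.

Import Order.TTheory GRing.Theory Num.Theory.
Import numFieldNormedType.Exports.

Local Open Scope classical_set_scope.
Local Open Scope ring_scope.

HB.mixin Record isHilbert (R : realType) H of CompleteNormedModule R H := {
  inner : {dot H for idfun};
  inner_norm : forall x : H, inner x x = `|x| ^+ 2 }.

#[short(type="hilbertType")]
HB.structure Definition Hilbert (R : realType) :=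
  {H of isHilbert R H & CompleteNormedModule R H}.

Section convex_analysis.
Context {R : realType} {H : hilbertType R}.
Implicit Types (f g : H -> \bar R) (A B : set H) (x y u p : H).

Local Open Scope ereal_scope.

Definition dom f : set H := [set x | f x < +oo].

(* `0 * +oo = 0` in `\bar R`, so the inequality is trivial for t = 0 and
   t = 1, and it bears on the open interval only. *)
Definition convex_efun f := forall (t : R) x y, (0 <= t <= 1)%R ->
  f (t *: x + (1 - t) *: y)%R <= t%:E * f x + (1 - t)%:E * f y.

Definition Gamma0 : set (H -> \bar R) := [set f |
  [/\ forall x, f x != -oo, lower_semicontinuous f, convex_efun f &
      dom f !=set0]].

Definition half_sqnorm : H -> \bar R := fun x => (`|x| ^+ 2 / 2)%:E.

Definition conjugate f : H -> \bar R :=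
  fun u => ereal_sup [set (inner x u)%:E - f x | x in setT].

(* The library sets `+oo + -oo = -oo`; this does not matter when neither
   function takes the value -oo. *)
Definition infconv f g : H -> \bar R :=
  fun x => ereal_inf [set f y + g (x - y)%R | y in setT].

Definition prox_argmin f x : set H := [set p |
  forall y, f p + half_sqnorm (x - p)%R <= f y + half_sqnorm (x - y)%R].

(* The default value 0 is irrelevant for f in Gamma0, where the minimizer
   exists and is unique. *)
Definition prox f : H -> H :=
  fun x => xget 0%R [set p | unique (prox_argmin f x) p].

Definition prox_operators : set (H -> H) :=
  [set T | exists2 f, Gamma0 f & T = prox f].

Definition minkowski_diff A B : set H := [set (x - y)%R | x in A & y in B].

(* For A containing 0, as in `sri`, allowing l = 0 would give the same set. *)
Definition cone A : set H :=
  [set (l *: x)%R | l in [set l : R | (0 < l)%R] & x in A].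

Definition closed_subspace A := submod_closed [in A] /\ closed A.

Definition sri A : set H :=
  [set x | A x /\ closed_subspace (cone (minkowski_diff A [set x]))].

End convex_analysis.

(* Main.v *)
(* For f in Gamma0 and p = prox_f x one has x - p in the subdifferential of f
   at p, so the Moreau envelope f^* [] q is a supremum of affine functions which
   at x is attained with slope p. Summing over f1 and f2, T1 x + T2 x is a
   subgradient at x of the right-hand side of the envelope identity. Its
   left-hand side is the envelope of the conjugate of h = f1 [] f2, which lies
   below a quadratic that touches it at x with slope prox_h x. Hence the two
   slopes agree.

   What remains is the Attouch-Brezis fact that h is in Gamma0. Let V be the
   closed subspace spanned by dom f1^* - dom f2^*. The value f1 y + f2 (z - y)
   does not change when y is projected on V. On V the sublevel sets are bounded
   by Banach-Steinhaus; choosing elements of almost minimal norm in them gives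
   convergent sequences, whence h is lower semicontinuous. *)
Require Import Defs.
From mathcomp Require Import all_boot all_order all_algebra.
From mathcomp Require Import all_classical all_reals all_analysis.
From mathcomp Require Import ring lra.

Set Implicit Arguments.
Unset Strict Implicit.
Unset Printing Implicit Defensive.

Import Order.TTheory GRing.Theory Num.Theory.
Import numFieldNormedType.Exports.

Local Open Scope classical_set_scope.
Local Open Scope ring_scope.

(** * Inner product and nested midpoint-convex sets *)

Section hilbert_space.
Context {R : realType} {H : hilbertType R}.
Implicit Types (x y z u v p : H) (K : nat -> set H).

Lemma innerDl x y z : inner (x + y) z = inner x z + inner y z.
Proof. exact: linearDl. Qed.

Lemma innerDr x y z : inner x (y + z) = inner x y + inner x z.
Proof. exact: linearDr. Qed.

Lemma innerNl x y : inner (- x) y = - inner x y.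
Proof. exact: linearNl. Qed.

Lemma innerNr x y : inner x (- y) = - inner x y.
Proof. exact: linearNr. Qed.

Lemma innerZl (a : R) x y : inner (a *: x) y = a * inner x y.
Proof. exact: linearZl_LR. Qed.

Lemma innerZr (a : R) x y : inner x (a *: y) = a * inner x y.
Proof. exact: linearZr_LR. Qed.

Lemma innerC x y : inner x y = inner y x.
Proof. by rewrite hermC expr0 mul1r. Qed.

Definition innerE := (innerDl, innerDr, innerNl, innerNr, innerZl, innerZr).

Lemma inner0l x : inner 0 x = 0. Proof. exact: linear0l. Qed.
Lemma inner0r x : inner x 0 = 0. Proof. exact: linear0r. Qed.

Lemma inner_ge0 x : 0 <= inner x x.
Proof. by rewrite inner_norm sqr_ge0. Qed.

Lemma inner_le_norm x y : inner x y <= `|x| * `|y|.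
Proof.
have [->|y0] := eqVneq y 0; first by rewrite inner0r normr0 mulr0.
have yp : 0 < `|y| by rewrite normr_gt0.
have [->|x0] := eqVneq x 0; first by rewrite inner0l normr0 mul0r.
have xp : 0 < `|x| by rewrite normr_gt0.
have := inner_ge0 (`|y| *: x - `|x| *: y).
rewrite !innerE (innerC y x) !inner_norm => h.
have : 0 <= (2 * (`|x| * `|y|)) * (`|x| * `|y| - inner x y) by nra.
by rewrite pmulr_rge0 ?subr_ge0// ?mulr_gt0.
Qed.

Lemma norm_inner_le x y : `|inner x y| <= `|x| * `|y|.
Proof.
rewrite ler_norml inner_le_norm andbT lerNl -innerNl.
by rewrite (le_trans (inner_le_norm _ _))// normrN.
Qed.

Lemma parallelogram x y :
  `|x - y| ^+ 2 = 2 * `|x| ^+ 2 + 2 * `|y| ^+ 2 - 4 * `|2^-1 *: (x + y)| ^+ 2.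
Proof. by rewrite -!inner_norm !innerE (innerC y x); field. Qed.

(* Elements of almost minimal norm form a Cauchy sequence; this replaces weak
   compactness of bounded closed convex sets. *)
Lemma nested_midconvex_cvg K (B : R) :
    (forall m n, (m <= n)%N -> K n `<=` K m) ->
    (forall n x y, K n x -> K n y -> K n (2^-1 *: (x + y))) ->
    (forall n, exists2 x, K n x & `|x| <= B) ->
  exists2 u : nat -> H, forall n, K n (u n) & cvgn u.
Proof.
move=> Kdec Kmid Kne.
pose S n := [set `|x| | x in K n].
have lbS n : has_lbound (S n) by exists 0 => _ [x _ <-]; exact: normr_ge0.
have S0 n : S n !=set0 by have [x Kx _] := Kne n; exists `|x|; exists x.
pose d n := inf (S n).
have dle n x : K n x -> d n <= `|x| by move=> Kx; apply: ge_inf => //; exists x.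
have d0 n : 0 <= d n.
  by apply: lb_le_inf => // _ [x _ <-]; exact: normr_ge0.
have dB n : d n <= B by have [x Kx xB] := Kne n; exact: le_trans (dle _ _ Kx) xB.
have dnd m n : (m <= n)%N -> d m <= d n.
  move=> mn; apply: lb_le_inf => // _ [x Kx <-]; apply: dle.
  exact: Kdec Kx.
have ex n : exists x, K n x /\ `|x| < d n + n.+1%:R^-1.
  have [|_ [x Kx <-] ?] := @inf_adherent _ (S n) n.+1%:R^-1 _ (conj (S0 n) (lbS n)).
    by rewrite invr_gt0.
  by exists x.
have [u uP] := choice ex.
exists u => [n|]; first by case: (uP n).
have dcvg : cvgn d.
  apply: nondecreasing_is_cvgn => //.
  by exists B => _ [n _ <-].
have B0 : 0 <= B := le_trans (d0 0) (dB 0).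
apply/cauchy_cvgP/cauchy_exP => e e0.
have e2 : 0 < e ^+ 2 by rewrite exprn_gt0.
(* With [l] the limit of [d], the parallelogram identity bounds the squared distance of two late
   terms by [4 (l + b)^2 - 4 (d m)^2], where [d m > l - b]. This is at most [16 l b + 8 b^2], hence
   below [16 (B + 1) b], as [l <= B] and [b <= 1]. *)
have [b [b0 b1 bB]] : exists b, [/\ 0 < b, b <= 1 & 16 * (B + 1) * b <= e ^+ 2].
  have c0 : 0 < 16 * (B + 1) by lra.
  exists (Num.min 1 (e ^+ 2 / (16 * (B + 1)))); split.
  - by rewrite lt_min ltr01 divr_gt0.
  - by rewrite ge_min lexx.
  - by rewrite mulrC -ler_pdivlMr ?ge_min ?lexx ?orbT.
have [N _ NP] : \forall n \near \oo, `|limn d - d n| < b.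
  by move/cvgrPdist_lt : dcvg; exact.
have [N' _ N'P] : \forall n \near \oo, n.+1%:R^-1 < b.
  have := @near_infty_natSinv_lt R (PosNum b0).
  exact.
pose m := (N + N')%N.
exists (u m), m => //= n /= mn; rewrite -ball_normE /=.
have [Km um] := uP m; have [Kn un] := uP n.
have ltN k : (m <= k)%N -> limn d - b < d k /\ `|u k| < limn d + b.
  move=> kN; have /NP : (N <= k)%N := leq_trans (leq_addr _ _) kN.
  have /N'P /= : (N' <= k)%N := leq_trans (leq_addl _ _) kN.
  have := nondecreasing_cvgn_le dnd dcvg k; have [_] := uP k.
  rewrite ltr_norml => uk dk ik /andP[_ kd]; split; first lra.
  by rewrite (lt_le_trans uk)// lerD// ltW.
have [dm um'] := ltN _ (leqnn m); have [_ un'] := ltN _ mn.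
have lB : limn d <= B by apply: limr_le => //; exact: nearW.
have dmid : d m <= `|2^-1 *: (u m + u n)|.
  by apply/dle/Kmid => //; exact: Kdec Kn.
have l0 : 0 <= limn d := le_trans (d0 m) (nondecreasing_cvgn_le dnd dcvg m).
have sq k : (m <= k)%N -> `|u k| ^+ 2 <= (limn d + b) ^+ 2.
  by move=> /ltN[_ /ltW uk]; rewrite lerXn2r// nnegrE ?normr_ge0// addr_ge0// ltW.
rewrite -(ltr_pXn2r (n := 2))// ?nnegrE// ?ltW// parallelogram.
have := sq _ (leqnn m); have := sq _ mn.
have : d m ^+ 2 <= `|2^-1 *: (u m + u n)| ^+ 2 by rewrite lerXn2r// nnegrE.
have := d0 m.
move: (`|u m| ^+ 2) (`|u n| ^+ 2) (`|2^-1 *: _| ^+ 2) => A1 A2 A3.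
have dl : d m <= limn d := nondecreasing_cvgn_le dnd dcvg m.
move: (limn d) (d m) dm dl l0 lB => l a al la l0 lB a0 aA A2l A1l.
have : 0 <= (a - (l - b)) * (a + l + b) by apply: mulr_ge0; lra.
have : 0 <= b * (l - a) by apply: mulr_ge0; lra.
have : 0 <= b * (1 - b) by apply: mulr_ge0; lra.
have : 0 <= b * (B - l) by apply: mulr_ge0; lra.
nra.
Qed.

End hilbert_space.

(** * Convexity, semicontinuity and existence of proximal points *)

Section extended_functions.
Context {R : realType} {H : hilbertType R}.
Implicit Types (f g : H -> \bar R) (x y z u v p w : H) (a b c r s t : R).

Lemma convex_efun_le f t x y a b : convex_efun f -> 0 <= t <= 1 ->
    (f x <= a%:E)%E -> (f y <= b%:E)%E ->
  (f (t *: x + (1 - t) *: y)%R <= (t * a + (1 - t) * b)%:E)%E.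
Proof.
move=> cf t01 fa fb; apply: le_trans (cf _ _ _ t01) _.
move/andP: t01 => [t0 t1].
by rewrite [leRHS]EFinD !EFinM leeD// lee_wpmul2l// ?lee_fin ?subr_ge0.
Qed.

(** Strict real bounds keep infinite values out of the arithmetic and suit infima:
    [infconv f g x < a] yields a point [y] that witnesses it. *)
Lemma convex_efunP f : (forall x, f x != -oo%E) ->
    (forall t x y a b, 0 < t < 1 -> (f x < a%:E)%E -> (f y < b%:E)%E ->
      (f (t *: x + (1 - t) *: y)%R <= (t * a + (1 - t) * b)%:E)%E) ->
  convex_efun f.
Proof.
move=> fNy cf t x y /andP[t0 t1].
have [->|tN0] := eqVneq t 0.
  by rewrite scale0r add0r subr0 scale1r mul0e mul1e add0e.
have [->|tN1] := eqVneq t 1.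
  by rewrite scale1r subrr scale0r addr0 mul0e mul1e adde0.
have tp : 0 < t by rewrite lt_neqAle eq_sym tN0.
have sp : 0 < 1 - t by rewrite subr_gt0 lt_neqAle tN1.
case fx: (f x) => [r||]; last by have := fNy x; rewrite fx.
  case fy: (f y) => [s||]; last by have := fNy y; rewrite fy.
    apply/lee_addgt0Pr => e e0; rewrite -!EFinM -!EFinD.
    have -> : t * r + (1 - t) * s + e = t * (r + e) + (1 - t) * (s + e) by ring.
    by apply: cf; rewrite ?fx ?fy ?lte_fin ?ltrDl// tp -subr_gt0.
  by rewrite gt0_muley ?lte_fin// addey ?leey.
by rewrite gt0_muley ?lte_fin// addye ?leey//;
  case: (f y) (fNy y) => [s||]//; rewrite gt0_muley ?lte_fin.
Qed.

Lemma lsc_cvg_le f (v : nat -> H) y c : lower_semicontinuous f ->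
    v @ \oo --> y -> (\forall n \near \oo, (f (v n) <= c%:E)%E) ->
  (f y <= c%:E)%E.
Proof.
move=> lf vy fv; rewrite leNgt; apply/negP => /lf[V Vy Vc].
have : \forall n \near \oo, V (v n) by exact: vy.
move=> VN; have [n [/Vc]] := filter_ex (filterI VN fv).
by rewrite ltNge => /negP.
Qed.

Lemma lte_addr_split (X Y : \bar R) c : X != -oo%E -> Y != -oo%E ->
    (c%:E < X + Y)%E ->
  exists a b, [/\ (a%:E < X)%E, (b%:E < Y)%E & c <= a + b].
Proof.
case: X => [X||]//; case: Y => [Y||]// _ _; rewrite ?lte_fin.
- move=> h; exists (X - (X + Y - c) / 2), (Y - (X + Y - c) / 2).
  by rewrite !lte_fin; split; lra.
- by move=> _; exists (X - 1), (c - X + 1); rewrite !lte_fin ltey; split => //; lra.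
- by move=> _; exists (c - Y + 1), (Y - 1); rewrite !lte_fin ltey; split => //; lra.
- by move=> _; exists c, 0; rewrite !ltey; split => //; lra.
Qed.

Lemma lsc_add_cvg_le f g (v w : nat -> H) y z c :
    (forall x, f x != -oo%E) -> (forall x, g x != -oo%E) ->
    lower_semicontinuous f -> lower_semicontinuous g ->
    v @ \oo --> y -> w @ \oo --> z ->
    (\forall n \near \oo, (f (v n) + g (w n) <= c%:E)%E) ->
  (f y + g z <= c%:E)%E.
Proof.
move=> f0 g0 lf lg vy wz fg; rewrite leNgt; apply/negP.
move=> /(lte_addr_split (f0 _) (g0 _))[a [b [/lf[V Vy Va] /lg[W Wz Wb] cab]]].
have VN : \forall n \near \oo, V (v n) by exact: vy.
have WN : \forall n \near \oo, W (w n) by exact: wz.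
have [n [[/Va fa /Wb gb]]] := filter_ex (filterI (filterI VN WN) fg).
by apply/negP; rewrite -ltNge (le_lt_trans _ (lteD fa gb))// lee_fin.
Qed.

Lemma half_sqnorm_lsc : lower_semicontinuous (@half_sqnorm R H).
Proof.
move=> x a; rewrite /half_sqnorm lte_fin => ax.
have cq : (fun y : H => `|y| ^+ 2 / 2) @ x --> `|x| ^+ 2 / 2.
  by apply: cvgMl; rewrite expr2; apply: cvgM; exact: cvg_norm.
exists [set y : H | a < `|y| ^+ 2 / 2]; last by move=> y; rewrite lte_fin.
exact: (cq _ (lt_nbhsr ax)).
Qed.

(** Lower semicontinuity bounds [f] below near a point [x0] of its domain; convexity along the
    segment from [x0] to a distant [y] carries this over, with a loss proportional to the
    distance. *)
Lemma Gamma0_linear_minorant f : Gamma0 f ->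
  exists a c, 0 <= c /\ forall y, ((a - c * `|y|)%:E <= f y)%E.
Proof.
move=> [fNy lf cf [x0 x0f]].
have [r fx0] : exists r, f x0 = r%:E.
  by move: x0f (fNy x0); rewrite /dom /=; case: (f x0) => // r; exists r.
have /lf[V /nbhs_ballP[d /= d0 dV] Vr] : ((r - 1)%:E < f x0)%E.
  by rewrite fx0 lte_fin ltrBlDr ltrDl.
exists (r - 1 - 2 / d * `|x0|), (2 / d); split => [|y]; first by rewrite divr_ge0 ?ltW.
have k0 : 0 < 2 / d by rewrite divr_gt0.
case fy: (f y) => [s||]; [|by rewrite leey|by have := fNy y; rewrite fy].
rewrite lee_fin.
have yx : `|y - x0| <= `|y| + `|x0| by exact: ler_normB.
have [yd|dy] := ltP `|y - x0| d.
  have : ((r - 1)%:E < f y)%E by apply/Vr/dV; rewrite -ball_normE /= distrC.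
  rewrite fy lte_fin => rs.
  have := mulr_ge0 (ltW k0) (normr_ge0 y); have := mulr_ge0 (ltW k0) (normr_ge0 x0); lra.
have n0 : 0 < `|y - x0| := lt_le_trans d0 dy.
(* The point [t *: y + (1 - t) *: x0] lies at distance [d / 2] from [x0], inside the ball where
   [f > r - 1]. Convexity then gives [t * (r - s) < 1]. *)
pose t := d / (2 * `|y - x0|).
have t0 : 0 < t by rewrite divr_gt0// mulr_gt0.
have t1 : t <= 1 by rewrite ler_pdivrMr ?mulr_gt0// mul1r; lra.
have : ((r - 1)%:E < f (t *: y + (1 - t) *: x0)%R)%E.
  apply/Vr/dV; rewrite -ball_normE /= distrC.
  have -> : t *: y + (1 - t) *: x0 - x0 = t *: (y - x0).
    by rewrite scalerBl scale1r addrA addrAC addrK -scalerBr.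
  rewrite normrZ gtr0_norm// /t mulrAC -mulf_div divff ?gt_eqF// mulr1; lra.
move=> /lt_le_trans/(_ (convex_efun_le cf _ _ _)) => /(_ s r).
rewrite (ltW t0) t1 fy fx0 !lexx => /(_ erefl erefl erefl).
rewrite lte_fin => h.
have tk : 1 = 2 / d * (t * `|y - x0|).
  by rewrite /t; field; rewrite gt_eqF//= gt_eqF.
have : r - s < 2 / d * `|y - x0|.
  by rewrite -(ltr_pM2l t0) mulrCA -tk; lra.
have := ler_wpM2l (ltW k0) yx; lra.
Qed.

Lemma add_half_sqnorm_le f y z c : f y != -oo%E ->
    (f y + half_sqnorm z <= c%:E)%E ->
  exists2 r, f y = r%:E & r + `|z| ^+ 2 / 2 <= c.
Proof.
by case: (f y) => [r||]//= _; rewrite -EFinD lee_fin => rc; exists r.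
Qed.

(** The points that minimize up to [1 / (n + 1)] form nested sets, stable under midpoints by
    convexity, and bounded because the quadratic term beats the linear minorant. A convergent
    selection tends to a minimizer by lower semicontinuity. *)
Lemma prox_argmin_ex f x : Gamma0 f -> exists p, prox_argmin f x p.
Proof.
move=> Gf; have [a [c [c0 fac]]] := Gamma0_linear_minorant Gf.
have [fNy lf cf [x0 x0f]] := Gf.
pose g y := (f y + half_sqnorm (x - y)%R)%E.
have glb y : ((a - c * `|x| - c * `|x - y| + `|x - y| ^+ 2 / 2)%:E <= g y)%E.
  rewrite [leLHS]EFinD /g leeD// (le_trans _ (fac y))// lee_fin.
  have : `|y| <= `|x| + `|x - y| by rewrite -{1}(subKr x y) ler_normB.
  move=> /(ler_wpM2l c0); lra.
pose S := [set s : R | exists y, (g y <= s%:E)%E].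
have S0 : S !=set0.
  move: x0f (fNy x0); rewrite /dom /=; case e : (f x0) => [r||]// _ _.
  by exists (r + `|x - x0| ^+ 2 / 2), x0; rewrite /g e.
have lbS : has_lbound S.
  exists (a - c * `|x| - c ^+ 2 / 2) => s [y]; apply: contraTT.
  rewrite -!ltNge => sl; apply: lt_le_trans (glb y); rewrite lte_fin.
  apply: lt_le_trans sl _.
  have := sqr_ge0 (`|x - y| - c); nra.
pose m := inf S.
have mg y : (m%:E <= g y)%E.
  case e : (g y) => [s||]; last 2 first.
  - by rewrite leey.
  - by have := glb y; rewrite e leNgt ltNyr.
  by rewrite lee_fin; apply: ge_inf => //; exists y; rewrite e.
pose K n := [set y | (g y <= (m + n.+1%:R^-1)%:E)%E].
have [C C0 CE] : exists2 C, 0 <= C & m + 1 - (a - c * `|x|) <= C.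
  exists (Num.max 0 (m + 1 - (a - c * `|x|))); first by rewrite le_max lexx.
  by rewrite le_max lexx orbT.
(* On [K n] the distance [D = |x - y|] satisfies [D ^ 2 / 2 - c * D <= C], which fails for
   [D > 2 * c + 2 * C + 2]. *)
have [||n|u Ku cu] := @nested_midconvex_cvg _ _ K (`|x| + (2 * c + 2 * C + 2)).
- move=> i j ij y; rewrite /K /= => /le_trans; apply.
  by rewrite lee_fin lerD2l lef_pV2 ?posrE// ler_nat.
- move=> n y z; rewrite /K /= => Ky Kz.
  have [r fy yM] := add_half_sqnorm_le (fNy y) Ky.
  have [r' fz zM] := add_half_sqnorm_le (fNy z) Kz.
  have half : 2^-1 *: (y + z) = 2^-1 *: y + (1 - 2^-1) *: z.
    by rewrite scalerDr; congr (_ + _ *: _); field.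
  have fm : (f (2^-1 *: (y + z)) <= (2^-1 * r + (1 - 2^-1) * r')%:E)%E.
    by rewrite half; apply: convex_efun_le; rewrite ?fy ?fz//; apply/andP; split; lra.
  rewrite /g; apply: le_trans (leeD fm (lexx _)) _; rewrite -EFinD lee_fin.
  have -> : x - 2^-1 *: (y + z) = 2^-1 *: ((x - y) + (x - z)).
    rewrite addrACA -opprD scalerBr; congr (_ - _).
    by rewrite scalerDr -scalerDl -[LHS]scale1r; congr (_ *: _); field.
  have := parallelogram (x - y) (x - z); have := sqr_ge0 `|x - y - (x - z)|.
  move: (m + _) yM zM => M yM zM; lra.
- have [|s [y gy] sm] := @inf_adherent _ S n.+1%:R^-1 _ (conj S0 lbS).
    by rewrite invr_gt0.
  have Ky : K n y by apply: le_trans gy _; rewrite lee_fin ltW.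
  exists y => //.
  have gm : a - c * `|x| - c * `|x - y| + `|x - y| ^+ 2 / 2 <= m + 1.
    rewrite -lee_fin (le_trans (glb y))// (le_trans Ky)// lee_fin lerD2l.
    by rewrite invf_le1// ler1n.
  have : `|y| <= `|x| + `|x - y| by rewrite -{1}(subKr x y) ler_normB.
  move=> /le_trans; apply; rewrite lerD2l leNgt; apply/negP => Dlt.
  have := mulr_ge0 c0 (normr_ge0 (x - y)).
  have : 0 <= (`|x - y| - (2 * c + 2 * C + 2)) * `|x - y| by apply: mulr_ge0 => //; lra.
  have : 0 <= C * (`|x - y| - 1) by apply: mulr_ge0 => //; lra.
  nra.
exists (limn u) => y.
apply: le_trans (mg y); apply/lee_addgt0Pr => e e0; rewrite -EFinD.
apply: (@lsc_add_cvg_le _ _ u (fun n => x - u n)) => //.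
- exact: half_sqnorm_lsc.
- by apply: cvgB => //; exact: cvg_cst.
near=> n; apply: le_trans (Ku n) _; rewrite lee_fin lerD2l ltW//.
near: n; exact: (@near_infty_natSinv_lt R (PosNum e0)).
Unshelve. all: by end_near. Qed.

End extended_functions.

(** * Proximity operator, subgradients and conjugates *)

Section proximity_operator.
Context {R : realType} {H : hilbertType R}.
Implicit Types (f g : H -> \bar R) (x y z u v p w : H) (a b c r s t : R).

(** Against a point of the segment from [p] to [y], a violation of size [e] enters to first order
    and the quadratic remainder only to second. *)
Lemma prox_argmin_subgradient f x p : Gamma0 f -> prox_argmin f x p ->
  exists2 r, f p = r%:E &
    forall y, ((r + inner (x - p) (y - p))%:E <= f y)%E.
Proof.
move=> [fNy _ cf [x0 x0f]] pmin.
have [s fx0] : exists s, f x0 = s%:E.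
  by move: x0f (fNy x0); rewrite /dom /=; case: (f x0) => // s; exists s.
have := pmin x0; rewrite fx0 -EFinD => /(add_half_sqnorm_le (fNy p))[r fp _].
exists r => // y.
case fy: (f y) => [r'||]; [|by rewrite leey|by have := fNy y; rewrite fy].
rewrite lee_fin leNgt; apply/negP => lt.
pose e := r + inner (x - p) (y - p) - r'.
have e0 : 0 < e by rewrite /e; lra.
pose N := `|y - p| ^+ 2.
have N0 : 0 <= N by exact: sqr_ge0.
(* Minimality of [p] reads [t * e <= t ^ 2 * N / 2], whereas this [t] gives [t * N = e - t * e < e].
   It is in the unit interval even for [N = 0]. *)
pose t := e / (e + N).
have eN : 0 < e + N by rewrite ltr_wpDr.
have t0 : 0 < t by rewrite divr_gt0.
have t1 : t <= 1 by rewrite ler_pdivrMr// mul1r lerDl.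
have tE : t * (e + N) = e by rewrite /t mulfVK// gt_eqF.
have := pmin (t *: y + (1 - t) *: p).
have -> : x - (t *: y + (1 - t) *: p) = (x - p) - t *: (y - p).
  rewrite scalerBl scale1r scalerBr !opprD !opprK !addrA.
  by congr (_ + _); rewrite addrAC.
have : (f (t *: y + (1 - t) *: p)%R <= (t * r' + (1 - t) * r)%:E)%E.
  by apply: convex_efun_le; rewrite ?fy ?fp// (ltW t0).
move=> /(leeD (lexx (half_sqnorm (x - p - t *: (y - p))))).
rewrite addeC => /[swap] /le_trans /[apply].
rewrite /half_sqnorm.
have -> : `|x - p - t *: (y - p)| ^+ 2 =
    `|x - p| ^+ 2 - 2 * t * inner (x - p) (y - p) + t ^+ 2 * N.
  rewrite /N -!inner_norm; move: (x - p) (y - p) => A B.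
  by rewrite !innerE (innerC B A); ring.
have te0 : 0 < t * e := mulr_gt0 t0 e0.
have := mulr_gt0 t0 te0.
have tN : t * N = e - t * e by apply: (addrI (t * e)); rewrite -mulrDr tE addrC subrK.
have : t ^+ 2 * N = t * e - t * (t * e) by rewrite expr2 -mulrA tN mulrBr.
rewrite fp -!EFinD lee_fin; move: (t ^+ 2 * N) => M.
rewrite /e; nra.
Qed.

(** Adding the two subgradient inequalities, each taken at the other point, leaves
    [|p - p'| ^ 2 <= 0]. *)
Lemma prox_argmin_uniq f x p p' : Gamma0 f ->
  prox_argmin f x p -> prox_argmin f x p' -> p = p'.
Proof.
move=> Gf /(prox_argmin_subgradient Gf)[r fp pP].
move=> /(prox_argmin_subgradient Gf)[r' fp' p'P].
have := pP p'; have := p'P p; rewrite fp fp' !lee_fin => h1 h2.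
apply/eqP; rewrite -subr_eq0 -normr_le0 -(ler_pXn2r (n := 2)) ?nnegrE//.
rewrite expr0n /= -inner_norm; move: h1 h2.
rewrite !innerE (innerC p p'); lra.
Qed.

Lemma prox_min f x : Gamma0 f -> prox_argmin f x (prox f x).
Proof.
move=> Gf; suff [] : unique (prox_argmin f x) (prox f x) by [].
apply: xgetPex; have [p pmin] := prox_argmin_ex x Gf; exists p; split=> // p'.
exact: prox_argmin_uniq.
Qed.

Lemma prox_subgradient f x : Gamma0 f ->
  exists2 r, f (prox f x) = r%:E &
    forall y, ((r + inner (x - prox f x) (y - prox f x))%:E <= f y)%E.
Proof. by move=> Gf; apply: prox_argmin_subgradient => //; exact: prox_min. Qed.

(** Replaces suprema by affine minorants of slope [u], so that later arguments compare values
    pointwise. *)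
Lemma conjugate_leP f u r :
  (conjugate f u <= r%:E)%E <-> forall x, ((inner x u - r)%:E <= f x)%E.
Proof.
split=> [fu x|fu].
  have : ((inner x u)%:E - f x <= conjugate f u)%E.
    by apply: ereal_sup_ubound; exists x.
  move=> /le_trans/(_ fu); case: (f x) => [s||]//=; rewrite ?leey//.
  by rewrite -EFinD !lee_fin; lra.
apply: ge_ereal_sup => _ [x _ <-]; have := fu x; case: (f x) => [s||] //= h.
  by move: h; rewrite -EFinD !lee_fin; lra.
by rewrite addeNy leNye.
Qed.

Lemma conjugateNy f u : dom f !=set0 -> conjugate f u != -oo%E.
Proof.
move=> [x fx]; rewrite gt_eqF//.
have : ((inner x u)%:E - f x <= conjugate f u)%E.
  by apply: ereal_sup_ubound; exists x.
by apply: lt_le_trans; move: fx; rewrite /dom /=; case: (f x) => // r; rewrite -EFinD ltNyr.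
Qed.

Lemma scale_Gamma0 f t : 0 < t -> Gamma0 f -> Gamma0 (fun x => t%:E * f x)%E.
Proof.
move=> t0 [fNy lf cf [x0 x0f]].
have gNy x : (t%:E * f x)%E != -oo%E.
  by case: (f x) (fNy x) => [r||]// _; rewrite gt0_muley ?lte_fin.
have ltE x a : ((a%:E < t%:E * f x) = ((a / t)%:E < f x))%E.
  case: (f x) (fNy x) => [r||]// _; last by rewrite gt0_muley ?lte_fin// !ltey.
  by rewrite -EFinM !lte_fin ltr_pdivrMr// mulrC.
have gtE x a : ((t%:E * f x < a%:E) = (f x < (a / t)%:E))%E.
  case: (f x) (fNy x) => [r||]// _; last by rewrite gt0_muley ?lte_fin// !ltNge !leey.
  by rewrite -EFinM !lte_fin ltr_pdivlMr// mulrC.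
split=> //.
- by move=> x a; rewrite ltE => /lf[V Vx Va]; exists V => // y /Va; rewrite ltE.
- apply: convex_efunP => // s x y a b /andP[s0 s1].
  rewrite !gtE => /ltW fa /ltW fb.
  have s01 : 0 <= s <= 1 by rewrite !ltW.
  have := lee_wpmul2l (_ : 0 <= t%:E)%E (convex_efun_le cf s01 fa fb).
  rewrite lee_fin => /(_ (ltW t0)) /le_trans; apply.
  have -> : s * a + (1 - s) * b = t * (s * (a / t) + (1 - s) * (b / t)).
    by field; rewrite gt_eqF.
  by rewrite EFinM.
- exists x0; move: x0f (fNy x0); rewrite /dom /=; case: (f x0) => // r _ _.
  by rewrite -EFinM ltey.
Qed.

End proximity_operator.

(** * Fenchel-Moreau theorem and closed subspaces *)

Section biconjugate.
Context {R : realType} {H : hilbertType R}.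
Implicit Types (f g : H -> \bar R) (V Y : set H) (x y z u v p w : H) (a b c r s t : R).

(* Fenchel-Moreau: the affine minorants given by the proximity operator of
   [f / n] at [x] have values at [x] which increase to [f x]. *)
Lemma Gamma0_le_biconjugate f x c : Gamma0 f ->
    (forall u r, (conjugate f u <= r%:E)%E -> inner x u - r <= c) ->
  (f x <= c%:E)%E.
Proof.
move=> Gf fc; have [fNy lf _ _] := Gf.
have [a [k [k0 fak]]] := Gamma0_linear_minorant Gf.
pose p n := prox (fun y => (n.+1%:R^-1)%:E * f y)%E x.
have pP n : exists2 r, f (p n) = r%:E & n.+1%:R * `|x - p n| ^+ 2 + r <= c.
  have n0 : 0 < n.+1%:R :> R by rewrite ltr0n.
  have ni0 : 0 < n.+1%:R^-1 :> R by rewrite invr_gt0.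
  have [r] := prox_subgradient x (scale_Gamma0 ni0 Gf); rewrite -/(p n).
  case fp : (f (p n)) (fNy (p n)) => [s||]// _; last by rewrite gt0_muley ?lte_fin.
  move=> [<-] pP; exists s => //.
  (* The slope [(n + 1) (x - p n)] is a subgradient of [f] at [p n]; the hypothesis [fc] for this
     slope is the bound sought. *)
  suff /fc : (conjugate f (n.+1%:R *: (x - p n)) <=
      (inner (p n) (n.+1%:R *: (x - p n)) - s)%:E)%E.
    apply: le_trans; rewrite !innerZr -inner_norm opprB addrCA.
    by rewrite -mulrBr -linearBl /= addrC.
  apply/conjugate_leP => y; have := pP y; case: (f y) (fNy y) => [q||]// _; rewrite ?leey//.
  rewrite -!EFinM !lee_fin innerZr innerZr !(innerC _ (x - p n)) innerDr innerNr.
  rewrite -(ler_pM2l n0) mulrA mulfV ?gt_eqF// mul1r => /(le_trans _); apply.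
  by rewrite mulrDr mulrA mulfV ?gt_eqF// mul1r; lra.
pose C := `|c - a + k * `|x| |.
have px : p @ \oo --> x.
  apply/cvgrPdist_lt => e e0; near=> n.
  rewrite ltNge; apply/negP => eD.
  have [r fp h] := pP n; have := fak (p n); rewrite fp lee_fin.
  have : `|p n| <= `|x| + `|x - p n| by rewrite -{1}(subKr x (p n)) ler_normB.
  move=> /(ler_wpM2l k0).
  (* If [D = |x - p n| >= e], the linear minorant gives [(n + 1) * D ^ 2 <= C + k * D <= (C / e + k)
     * D], against [(n + 1) * e > C / e + k]. *)
  have : n.+1%:R > (C / e + k) / e.
    rewrite -natr1 ltr_wpDr//; near: n; exact: nbhs_infty_gtr.
  rewrite ltr_pdivrMr// => ne.
  have : c - a + k * `|x| <= C by exact: ler_norm.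
  have C0 : 0 <= C by exact: normr_ge0.
  have CE : C = C / e * e by rewrite mulfVK// gt_eqF.
  have : 0 <= C / e by rewrite divr_ge0// ltW.
  move: (C / e) ne CE => q ne CE q0 CC.
  have D0 : 0 < `|x - p n| := lt_le_trans e0 eD.
  have h1 := mulr_ge0 q0 (_ : 0 <= `|x - p n| - e); rewrite subr_ge0 in h1.
  move: (n.+1%:R) ne h => m ne h.
  have m0 : 0 <= m by rewrite -(pmulr_lge0 _ e0) ltW// (le_lt_trans _ ne)// addr_ge0.
  have := mulr_ge0 (mulr_ge0 m0 (ltW D0)) (_ : 0 <= `|x - p n| - e).
  rewrite subr_ge0 => /(_ eD); have := h1 eD.
  have : 0 < (m * e - (q + k)) * `|x - p n| by rewrite mulr_gt0// subr_gt0.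
  nra.
apply: (lsc_cvg_le lf px); near=> n; have [r -> h] := pP n.
rewrite lee_fin (le_trans _ h)// lerDr mulr_ge0//.
Unshelve. all: by end_near. Qed.

(** All affine minorants of [f] increase by the same [c] along [w], and [f] is their supremum by
    Fenchel-Moreau. *)
Lemma conjugate_dom_const f w c x a : Gamma0 f ->
    (forall u, dom (conjugate f) u -> inner w u = c) ->
  (f x <= a%:E)%E -> (f (x + w)%R <= (a + c)%:E)%E.
Proof.
move=> Gf wc fxa; apply: Gamma0_le_biconjugate => // u r ur.
rewrite innerDl wc; last by rewrite /dom /= (le_lt_trans ur)// ltry.
have /conjugate_leP/(_ x) := ur => /le_trans/(_ fxa); rewrite lee_fin; lra.
Qed.

Lemma closed_subspaceZD V t x y : closed_subspace V -> V x -> V y -> V (t *: x + y).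
Proof.
move=> [[_ VZD] _] Vx Vy.
by have := VZD t x y; rewrite !inE; apply.
Qed.

(** The projection is the proximal point of the indicator function of [V]; the subgradient
    inequality in the directions [w] and [- w] is orthogonality. *)
Lemma closed_subspace_projection V x : closed_subspace V ->
  exists2 p, V p & forall w, V w -> inner (x - p) w = 0.
Proof.
move=> sV; have V0 : V 0 by case: sV => [[]]; rewrite inE.
pose f y : \bar R := if y \in V then 0%E else +oo%E.
have fV y : f y != +oo%E -> V y.
  by rewrite /f; case: ifPn => // /set_mem.
have Vf y : V y -> f y = 0%E by move=> /mem_set; rewrite /f => ->.
have fNy y : f y != -oo%E by rewrite /f; case: ifP.
have Gf : Gamma0 f.
  split=> //.
  - move=> y a; have [Vy|nVy] := pselect (V y).
      rewrite (Vf _ Vy) => a0; exists setT; first exact: filterT.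
      by move=> z _; rewrite /f; case: ifP => // _; rewrite ltry.
    move=> _; exists (~` V).
      by apply: open_nbhs_nbhs; split => //; apply: closed_openC; case: sV.
    by move=> z Vz; rewrite /f memNset// ltry.
  - apply: convex_efunP => // t y z a b /andP[t0 t1] fa fb.
    have Vy : V y by apply: fV; rewrite lt_eqF// (lt_trans fa)// ltry.
    have Vz : V z by apply: fV; rewrite lt_eqF// (lt_trans fb)// ltry.
    move: fa fb; rewrite !Vf//; last first.
      apply: closed_subspaceZD => //.
      by rewrite -[_ *: z]addr0; exact: closed_subspaceZD.
    rewrite !lte_fin lee_fin => a0 b0.
    by rewrite addr_ge0// mulr_ge0 ?ltW// subr_gt0.
  - by exists 0; rewrite /dom /= Vf.
have [r fp pP] := prox_subgradient x Gf.
have Vp : V (prox f x) by apply: fV; rewrite fp.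
exists (prox f x) => // w Vw.
have VpD t : V (prox f x + t *: w) by rewrite addrC; exact: closed_subspaceZD.
move: fp; rewrite (Vf _ Vp) => -[r0].
have h t : t * inner (x - prox f x) w <= 0.
  have := pP _; move=> /(_ (prox f x + t *: w)).
  by rewrite Vf// -r0 add0r (addrC (prox f x)) addrK innerZr lee_fin.
by have := h 1; have := h (-1); lra.
Qed.

(** Banach-Steinhaus is applied to the functionals [inner u] on all of [H]: for [u] in [V] they
    agree at [v] and at its projection on [V]. One-sided bounds at the projection and at its
    opposite give the absolute bound. *)
Lemma closed_subspace_bounded V Y : closed_subspace V -> Y `<=` V ->
    (forall v, V v -> exists M, forall u, Y u -> inner u v <= M) ->
  exists M, forall u, Y u -> `|u| <= M.
Proof.
move=> sV YV Yb.
have [|v|M MP] := @Banach_Steinhauss R H R^o [set inner u | u in Y] _ _ 1.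
- move=> _ [u _ <-]; split => [r|t x y].
    exists (`|u| * r) => x xr.
    by rewrite (le_trans (norm_inner_le _ _))// ler_wpM2l.
  by rewrite innerDr innerZr.
- have [p Vp pP] := closed_subspace_projection v sV.
  have pE u : Y u -> inner u v = inner u p.
    by move=> /YV /pP; rewrite innerC innerDr innerNr; lra.
  have [M MP] := Yb _ Vp.
  have [|M' M'P] := Yb (- p).
    by rewrite -scaleN1r -[_ *: p]addr0; apply: closed_subspaceZD => //; case: sV => [[]]; rewrite inE.
  exists (Num.max M M') => _ [u Yu <-]; rewrite pE//.
  have := M'P _ Yu; have := MP _ Yu; rewrite innerNr => h1 h2.
  rewrite ler_norml lerNl !le_max h1 h2/= orbT//.
exists M => u Yu.
have [->|u0] := eqVneq u 0.
  rewrite normr0.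
  have := MP _ (ex_intro2 _ _ u Yu erefl) 0.
  by rewrite inner0r !normr0; apply.
have un : 0 < `|u| by rewrite normr_gt0.
have := MP _ (ex_intro2 _ _ u Yu erefl) (`|u|^-1 *: u).
rewrite innerZr inner_norm expr2 mulrA mulVf ?gt_eqF// mul1r normr_id; apply.
by rewrite normrZ normfV normr_id mulVf// gt_eqF.
Qed.

End biconjugate.

(** * Infimal convolution, its conjugate and Moreau envelopes *)

Section infimal_convolution.
Context {R : realType} {H : hilbertType R}.
Implicit Types (f g : H -> \bar R) (x y z u v p w : H) (a b c r s t : R).

Lemma infconv_le f g x y : (infconv f g x <= f y + g (x - y)%R)%E.
Proof. by apply: ereal_inf_lbound; exists y. Qed.

Lemma infconv_ge f g x (c : \bar R) :
  (forall y, c <= f y + g (x - y)%R)%E -> (c <= infconv f g x)%E.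
Proof. by move=> h; apply: le_ereal_inf_tmp => _ [y _ <-]. Qed.

Lemma infconv_lt f g x (c : \bar R) : (infconv f g x < c)%E ->
  exists y, (f y + g (x - y)%R < c)%E.
Proof. by move=> /ereal_inf_lt[_ [y _ <-]]; exists y. Qed.

Lemma add_fin f g y z c : f y != -oo%E -> g z != -oo%E ->
    (f y + g z <= c%:E)%E ->
  exists a b, [/\ f y = a%:E, g z = b%:E & a + b <= c].
Proof.
case: (f y) => [a||]//; case: (g z) => [b||]// _ _.
by rewrite -EFinD lee_fin; exists a, b.
Qed.

Lemma convex_add_le f g t y y' z z' a b :
    (forall x, f x != -oo%E) -> (forall x, g x != -oo%E) ->
    convex_efun f -> convex_efun g -> 0 <= t <= 1 ->
    (f y + g z <= a%:E)%E -> (f y' + g z' <= b%:E)%E ->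
  (f (t *: y + (1 - t) *: y')%R + g (t *: z + (1 - t) *: z')%R <=
    (t * a + (1 - t) * b)%:E)%E.
Proof.
move=> fNy gNy cf cg t01 /(add_fin (fNy _) (gNy _))[r [s [fy gz rs]]].
move=> /(add_fin (fNy _) (gNy _))[r' [s' [fy' gz' rs']]].
have := leeD (@convex_efun_le _ _ f t y y' r r' cf t01 _ _)
             (@convex_efun_le _ _ g t z z' s s' cg t01 _ _).
rewrite fy fy' gz gz' !lexx => /(_ erefl erefl erefl erefl) /le_trans; apply.
move/andP: t01 => [t0 t1]; rewrite -EFinD lee_fin.
have := ler_wpM2l t0 rs; have : (1 - t) * (r' + s') <= (1 - t) * b.
  by rewrite ler_wpM2l// subr_ge0.
lra.
Qed.

Lemma conjugate_infconv f g : (forall x, f x != -oo%E) -> (forall x, g x != -oo%E) ->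
    dom f !=set0 -> dom g !=set0 ->
  conjugate (infconv f g) = (conjugate f \+ conjugate g)%E.
Proof.
move=> fNy gNy df dg; apply/funext => u; apply/eqP; rewrite eq_le; apply/andP; split.
- have := conjugateNy u df; have := conjugateNy u dg => /=.
  case fu : (conjugate f u) => [a||]; case gu : (conjugate g u) => [b||]// _ _;
    rewrite ?leey//.
  rewrite -EFinD; apply/conjugate_leP => x; apply: infconv_ge => y.
  have /conjugate_leP/(_ y) : (conjugate f u <= a%:E)%E by rewrite fu.
  have /conjugate_leP/(_ (x - y)) : (conjugate g u <= b%:E)%E by rewrite gu.
  move=> h1 h2; apply: le_trans (leeD h2 h1).
  by rewrite -EFinD lee_fin innerDl innerNl; lra.
- case fgu : (conjugate (infconv f g) u) => [c||]; first last.
  + have : dom (infconv f g) !=set0.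
      have [y fy] := df; have [z gz] := dg; exists (y + z).
      rewrite /dom /= (le_lt_trans (infconv_le _ _ _ y))// [y + z]addrC addrK.
      by rewrite lte_add_pinfty.
    by move=> /(conjugateNy u); rewrite fgu.
  + by rewrite leey.
  have /conjugate_leP fgc : (conjugate (infconv f g) u <= c%:E)%E by rewrite fgu.
  (* The supremum over pairs [(y, z)] is separated one variable at a time: a fixed [y] shows that
     the conjugate of [g] is finite at [u], and then [y] varies. *)
  have gle y s : (f y <= s%:E)%E -> (conjugate g u <= (c - inner y u + s)%:E)%E.
    move=> fy; apply/conjugate_leP => z.
    have := le_trans (fgc (y + z)) (infconv_le _ _ _ y); rewrite [y + z]addrC addrK.
    move: fy (fNy y); case: (f y) => [s'||]//; rewrite lee_fin => ss _.
    case: (g z) (gNy z) => [b||]// _; rewrite ?leey// -EFinD !lee_fin innerDl; lra.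
  have [y0 fy0] := df.
  have gfin : exists b, conjugate g u = b%:E.
    move: fy0 (fNy y0) (gle y0); rewrite /dom /=; case: (f y0) => [s||]// _ _.
    move=> /(_ s (lexx _)); case: (conjugate g u) (conjugateNy u dg) => [b||]//.
    by exists b.
  have [b gu] := gfin; rewrite /= gu.
  suff : (conjugate f u <= (c - b)%:E)%E.
    by move=> /(leeD2r b%:E) /le_trans; apply; rewrite -EFinD subrK.
  apply/conjugate_leP => y; case fy : (f y) (fNy y) => [s||]// _; rewrite ?leey//.
  by have := gle y s; rewrite fy lexx gu !lee_fin => /(_ erefl); lra.
Qed.

(** Combines Fenchel-Young at [p] with [|x - u - p| ^ 2 >= 0]. The minorant is affine in [x] with
    slope [p]. *)
Lemma envelope_conjugate_ge f p r x : f p = r%:E ->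
  ((inner x p - `|p| ^+ 2 / 2 - r)%:E <= infconv (conjugate f) half_sqnorm x)%E.
Proof.
move=> fp; apply: infconv_ge => u.
have : ((inner p u)%:E - f p <= conjugate f u)%E by apply: ereal_sup_ubound; exists p.
move=> /(leeD2r (half_sqnorm (x - u))) /(le_trans _); apply.
rewrite fp /half_sqnorm -EFinB -EFinD lee_fin -!inner_norm.
have := inner_ge0 (x - u - p); rewrite !innerE (innerC u x) (innerC p x) (innerC p u); lra.
Qed.

(** The infimum is estimated at [x - prox f x], where the subgradient inequality bounds the
    conjugate. At [y = x] the quadratic meets the affine bound of [envelope_conjugate_ge] for
    [p = prox f x]. *)
Lemma envelope_conjugate_le f x y r : Gamma0 f -> f (prox f x) = r%:E ->
  (infconv (conjugate f) half_sqnorm y <=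
    (inner (prox f x) (x - prox f x) - r + `|y - x + prox f x| ^+ 2 / 2)%:E)%E.
Proof.
move=> Gf fp; have [r'] := prox_subgradient x Gf; rewrite fp => -[<-].
move: (prox f x) => p pP; apply: le_trans (infconv_le _ _ _ (x - p)) _.
rewrite EFinD opprB addrA addrAC; apply: leeD => //; apply/conjugate_leP => z.
by apply: le_trans (pP z); rewrite lee_fin !(innerC _ (x - p)) innerDr innerNr; lra.
Qed.

End infimal_convolution.

(** * Attouch-Brezis: membership of [infconv f g] in [Gamma0] *)

Section attouch_brezis.
Context {R : realType} {H : hilbertType R}.
Context (f g : H -> \bar R) (Gf : Gamma0 f) (Gg : Gamma0 g).
Implicit Types (x y z u v p w : H) (a b c r s t : R).

(** The difference with [[set 0]] is kept so that [closed_subspace V] is exactly what [sri] at 0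
    asserts. *)
Let V := cone (minkowski_diff
  (minkowski_diff (dom (conjugate f)) (dom (conjugate g))) [set 0]).

Context (sV : closed_subspace V) (u0 : H).
Context (fu0 : dom (conjugate f) u0) (gu0 : dom (conjugate g) u0).

Let fNy x : f x != -oo%E. Proof. by case: Gf. Qed.
Let gNy x : g x != -oo%E. Proof. by case: Gg. Qed.
Let df : dom f !=set0. Proof. by case: Gf. Qed.
Let dg : dom g !=set0. Proof. by case: Gg. Qed.

Let domV u v : dom (conjugate f) u -> dom (conjugate g) v -> V (u - v).
Proof.
move=> du dv; exists 1 => //=; exists (u - v); last by rewrite scale1r.
by exists (u - v); [exists u => //; exists v|exists 0 => //; rewrite subr0].
Qed.

Lemma dom_conjugate_fin (h : H -> \bar R) u : dom h !=set0 ->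
  dom (conjugate h) u -> exists r, conjugate h u = r%:E.
Proof.
by move=> dh; move: (conjugateNy u dh); rewrite /dom /=; case: conjugate => // r; exists r.
Qed.

(** Each element of [V] is a positive multiple of one difference [u - u'] of points of the two
    conjugate domains. Fenchel-Young for [f] at [y], [u] and for [g] at [z - y], [u'] bounds
    [inner y (u - u')], as [closed_subspace_bounded] asks. *)
Lemma infconv_sublevel_bounded b c :
  exists M, forall y, V y /\ (exists2 z, `|z| <= b & (f y + g (z - y)%R <= c%:E)%E) ->
    `|y| <= M.
Proof.
apply: (closed_subspace_bounded sV) => [y []//|v].
move=> [l /= l0 [_ [_ [u du [u' du' <-]] [_ -> <-]] <-]].
have [r ur] := dom_conjugate_fin df du; have [r' ur'] := dom_conjugate_fin dg du'.
exists (l * (c + r + r' + b * `|u'|)) => y [_ [z zb]].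
move=> /(add_fin (fNy _) (gNy _))[s [s' [fy gz ss]]].
rewrite innerZr (ler_wpM2l (ltW l0))// subr0 innerDr innerNr.
have /conjugate_leP/(_ y) : (conjugate f u <= r%:E)%E by rewrite ur.
have /conjugate_leP/(_ (z - y)) : (conjugate g u' <= r'%:E)%E by rewrite ur'.
rewrite fy gz !lee_fin innerDl innerNl => h1 h2.
have : - inner z u' <= b * `|u'|.
  rewrite -innerNl (le_trans (inner_le_norm _ _))// normrN.
  by rewrite ler_wpM2r.
lra.
Qed.

(* Moving [y] by a vector orthogonal to [V] does not change
   [f y + g (z - y)], since [f] and [g] change by opposite constants. *)
Lemma infconv_sublevel_proj z y c : (f y + g (z - y)%R <= c%:E)%E ->
  exists2 p, V p & (f p + g (z - p)%R <= c%:E)%E.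
Proof.
move=> /(add_fin (fNy _) (gNy _))[s [s' [fy gz ss]]].
have [p Vp pP] := closed_subspace_projection y sV; exists p => //.
have -> : p = y + (p - y) by rewrite addrC subrK.
have -> : z - (y + (p - y)) = z - y + (y - p) by rewrite opprD opprB addrA.
(* Since [u0] lies in both conjugate domains, each of their points differs from [u0] by an element
   of [V] up to sign; hence [p - y] pairs to [k] with all of them. *)
pose k := inner (p - y) u0.
have -> : c = (s + k) + (c - s - k) by ring.
rewrite EFinD; apply: leeD.
  apply: conjugate_dom_const => // [u du|]; last by rewrite fy.
  by have := pP _ (domV du gu0); rewrite /k -opprB innerNl innerDr innerNr; lra.
apply: (@le_trans _ _ (s' - k)%:E); last by rewrite lee_fin; lra.
apply: conjugate_dom_const => // [u du|]; last by rewrite gz.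
by have := pP _ (domV fu0 du); rewrite /k -(opprB y p) innerDr innerNr innerNl; lra.
Qed.

(** Decompositions of points near [x] are projected on [V], where they are bounded; a convergent
    choice of them yields in the limit a decomposition of [x] itself. *)
Lemma infconv_le_cluster x a :
    (forall e, 0 < e -> exists2 z, `|x - z| <= e & (infconv f g z <= a%:E)%E) ->
  (infconv f g x <= a%:E)%E.
Proof.
move=> xa.
(* The level is relaxed as well as the distance, since the infimum at [z] is not known to be
   attained. *)
pose K n := [set y | V y /\ exists2 z, `|x - z| <= n.+1%:R^-1 &
  (f y + g (z - y)%R <= (a + n.+1%:R^-1)%:E)%E].
have n1 n : n.+1%:R^-1 <= 1 :> R by rewrite invf_le1// ler1n.
have nn m n : (m <= n)%N -> n.+1%:R^-1 <= m.+1%:R^-1 :> R.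
  by move=> mn; rewrite lef_pV2 ?posrE// ler_nat.
have [M MP] := infconv_sublevel_bounded (`|x| + 1) (a + 1).
have [|n y y' [Vy [z xz yz]] [Vy' [z' xz' yz']]|n|u Ku cu] := @nested_midconvex_cvg _ _ K M.
- move=> m n /nn mn y [Vy [z xz yz]]; split => //; exists z; first exact: le_trans mn.
  by rewrite (le_trans yz)// lee_fin lerD2l.
- have half (w w' : H) : 2^-1 *: (w + w') = 2^-1 *: w + (1 - 2^-1) *: w'.
    by rewrite scalerDr; congr (_ + _ *: _); field.
  split.
    rewrite half; apply: closed_subspaceZD => //.
    by rewrite -[_ *: y']addr0; apply: closed_subspaceZD => //; case: sV => [[]]; rewrite inE.
  exists (2^-1 *: (z + z')).
    have -> : x - 2^-1 *: (z + z') = 2^-1 *: ((x - z) + (x - z')).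
      rewrite addrACA -opprD scalerBr; congr (_ - _).
      by rewrite scalerDr -scalerDl -[LHS]scale1r; congr (_ *: _); field.
    rewrite normrZ ger0_norm ?invr_ge0// ler_pdivrMl//.
    by rewrite (le_trans (ler_normD _ _))// mulr_natl mulr2n lerD.
  rewrite -scalerBr opprD addrACA (half y) (half (z - y)).
  move: (a + _) yz yz' => c yz yz'.
  have -> : c = 2^-1 * c + (1 - 2^-1) * c by ring.
  apply: convex_add_le => //; [by case: Gf|by case: Gg|].
  by apply/andP; split; lra.
- have ni0 : 0 < n.+1%:R^-1 :> R by rewrite invr_gt0.
  have [z xz za] := xa _ ni0.
  have /infconv_lt[y /ltW /infconv_sublevel_proj[p Vp pz]] :
      (infconv f g z < (a + n.+1%:R^-1)%:E)%E.
    by rewrite (le_lt_trans za)// lte_fin ltrDl.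
  exists p; first by split => //; exists z.
  apply: MP; split=> //; exists z; last by rewrite (le_trans pz)// lee_fin lerD2l.
  by rewrite -{1}(subKr x z) (le_trans (ler_normB _ _))// lerD2l (le_trans xz).
have ex n : exists z, `|x - z| <= n.+1%:R^-1 /\
    (f (u n) + g (z - u n)%R <= (a + n.+1%:R^-1)%:E)%E.
  by have [_ [z ? ?]] := Ku n; exists z.
have [z zP] := choice ex.
have zx : z @ \oo --> x.
  apply/cvgrPdist_lt => e e0; near=> n; have [xz _] := zP n.
  apply: le_lt_trans xz _; near: n; exact: (@near_infty_natSinv_lt R (PosNum e0)).
apply: le_trans (infconv_le _ _ _ (limn u)) _; apply/lee_addgt0Pr => e e0; rewrite -EFinD.
apply: (@lsc_add_cvg_le _ _ _ _ u (fun n => z n - u n)) => //.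
- by case: Gf.
- by case: Gg.
- exact: cvgB.
near=> n; have [_ h] := zP n; apply: le_trans h _; rewrite lee_fin lerD2l ltW//.
near: n; exact: (@near_infty_natSinv_lt R (PosNum e0)).
Unshelve. all: by end_near. Qed.

Lemma infconv_Gamma0 : Gamma0 (infconv f g).
Proof.
have [_ _ cf _] := Gf; have [_ _ cg _] := Gg.
have fgNy x : infconv f g x != -oo%E.
  rewrite gt_eqF//.
  have [r ur] := dom_conjugate_fin df fu0; have [r' ur'] := dom_conjugate_fin dg gu0.
  have : (conjugate (infconv f g) u0 <= (r + r')%:E)%E.
    by rewrite conjugate_infconv//= ur ur'.
  by move=> /conjugate_leP/(_ x); apply: lt_le_trans; rewrite ltNyr.
split=> //.
- move=> x a ax.
  (* Without such a ball, points arbitrarily close to [x] have value at most [a], and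
     [infconv_le_cluster] contradicts [ax]. *)
  have [[e [e0 eP]]|nP] := pselect (exists e, 0 < e /\
      forall z, `|x - z| <= e -> (a%:E < infconv f g z)%E).
    exists (ball x e); first exact: nbhsx_ballx.
    by move=> z; rewrite -ball_normE => /ltW /eP.
  have : (infconv f g x <= a%:E)%E; last by rewrite leNgt ax.
  apply: infconv_le_cluster => e e0; apply: contrapT => h; apply: nP; exists e; split=> // z xz.
  by rewrite ltNge; apply/negP => za; apply: h; exists z.
- apply: convex_efunP => // t x y a b /andP[t0 t1].
  move=> /infconv_lt[y1 /ltW h1] /infconv_lt[y2 /ltW h2].
  apply: le_trans (infconv_le _ _ _ (t *: y1 + (1 - t) *: y2)) _.
  have -> : t *: x + (1 - t) *: y - (t *: y1 + (1 - t) *: y2) =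
      t *: (x - y1) + (1 - t) *: (y - y2).
    by rewrite opprD addrACA !scalerBr.
  by apply: convex_add_le => //; rewrite !ltW.
- have [y fy] := df; have [z gz] := dg; exists (y + z).
  rewrite /dom /= (le_lt_trans (infconv_le _ _ _ y))// [y + z]addrC addrK.
  by rewrite lte_add_pinfty.
Qed.

End attouch_brezis.

(** * Sum of two proximity operators *)

Theorem proposition3p16 (R : realType) (H : hilbertType R) (T1 T2 : H -> H)
    (f1 f2 : H -> \bar R) :
  Gamma0 f1 -> Gamma0 f2 -> T1 = prox f1 -> T2 = prox f2 ->
  sri (minkowski_diff (dom (conjugate f1)) (dom (conjugate f2))) 0%R ->
  infconv (conjugate f1 \+ conjugate f2)%E half_sqnorm =
    (infconv (conjugate f1) half_sqnorm \+
     infconv (conjugate f2) half_sqnorm)%E ->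
  prox_operators (T1 \+ T2)%R /\
  (Gamma0 (infconv f1 f2) /\ (T1 \+ T2)%R = prox (infconv f1 f2)).
Proof.
move=> G1 G2 -> -> [[u fu [u' gu' /eqP]]]; rewrite subr_eq0 => /eqP uu'.
rewrite -{}uu' in gu'; move=> sV envE.
have G : Gamma0 (infconv f1 f2) by exact: infconv_Gamma0 sV u fu gu'.
suff E : (prox f1 \+ prox f2)%R = prox (infconv f1 f2).
  by split; [exists (infconv f1 f2)|].
have [N1 _ _ d1] := G1; have [N2 _ _ d2] := G2.
rewrite -conjugate_infconv// in envE.
apply/funext => x /=.
have [r1 p1 _] := prox_subgradient x G1.
have [r2 p2 _] := prox_subgradient x G2.
have [r p _] := prox_subgradient x G.
have ub y := envelope_conjugate_le y G p.
have lb := envelope_conjugate_ge x p.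
rewrite envE /= in lb.
have := le_trans lb (leeD (envelope_conjugate_le x G1 p1) (envelope_conjugate_le x G2 p2)).
(* Bounds are compared at [x] and at [x + d]. In between, the affine ones grow by
   [inner d (prox f1 x + prox f2 x)] in total and the quadratic one by [inner d (prox (infconv f1
   f2) x) + |d| ^ 2 / 2]; hence [|d| ^ 2 <= |d| ^ 2 / 2]. *)
set d := prox f1 x + prox f2 x - prox (infconv f1 f2) x.
have := le_trans (leeD (envelope_conjugate_ge (x + d) p1) (envelope_conjugate_ge (x + d) p2)).
move=> /(_ _ (le_trans _ (ub (x + d)))); rewrite envE /= => /(_ (lexx _)).
rewrite -!EFinD !lee_fin subrr !add0r (addrC x d) addrK => h1 h2.
apply/eqP; rewrite -subr_eq0 -normr_le0 -(ler_pXn2r (n := 2)) ?nnegrE// -/d expr0n /=.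
have dE : inner d (prox f1 x) + inner d (prox f2 x) =
    inner d d + inner d (prox (infconv f1 f2) x).
  by rewrite -!innerDr /d subrK.
move: h1 h2; rewrite -!inner_norm; move: d dE => d dE.
rewrite !innerE (innerC (prox (infconv f1 f2) x) d) !(innerC _ x); lra.
Qed.
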